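(* Let $n\in\mathbb N$, $a,\alpha\in\mathbb R$. The derivative of order $s=n$ (first definition) of the function $f(x)=ax^{\alpha}$, $x>0$, coincides with the ordinary $n$-th derivative of $f$; that is, every derivative of order $n$ of $f$ in the sense of the first definition equals $f^{(n)}$ on $(0,\infty)$.
   Context: First definition. For $(s,\alpha)\in\mathbb Q\times\mathbb R\setminus\{(-1,-1)\}$ and $a\in\mathbb R$, a derivative of order $s$ of $f(x)=ax^\alpha$ ($x>0$) is any function of the form $$\frac{d^s(ax^\alpha)}{dx^s}=a\frac{\Gamma(\alpha+1)}{\Gamma(\alpha-s+1)}x^{\alpha-s}+\sum_{k=-\infty}^{-1}c_k\frac{x^{k-s}}{\Gamma(k-s+1)},$$ where $(c_k)_{k\le -1}$ are arbitrary finite real constants. Conventions: $\Gamma$ is the gamma function (infinite at $0,-1,-2,\dots$), so $1/\Gamma(z)=0$ for $z\in\{0,-1,-2,\dots\}$; the quotient $\Gamma(\alpha+1)/\Gamma(\alpha-s+1)$ means $\lim_{z\to\alpha}\Gamma(z+1)/\Gamma(z-s+1)$. *)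

(* Defs.v *)
From Stdlib Require Export Reals ZArith QArith Qreals.
From Stdlib Require Import ClassicalEpsilon.
From Coquelicot Require Export Coquelicot.
Open Scope R_scope.

(* Converges exactly when 0 < z. *)
Definition Gamma_integral (z : R) : R :=
  RInt_gen (fun t => Rpower t (z - 1) * exp (- t))
    (at_right 0) (Rbar_locally p_infty).

(* z (z + 1) ... (z + m - 1) *)
Fixpoint rising (z : R) (m : nat) : R :=
  match m with
  | O => 1
  | S m' => rising z m' * (z + INR m')
  end.

(* The least natural m with 0 < z + m; it is 0 when 0 < z. *)
Definition Gamma_shift (z : R) : nat := Z.to_nat (up (- z)).

(* Euler's integral for 0 < z, extended to the other reals by
   Gamma (z + 1) = z Gamma z.  The value at a pole is meaningless. *)
Definition Gamma (z : R) : R :=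
  Gamma_integral (z + INR (Gamma_shift z)) / rising z (Gamma_shift z).

Definition Gamma_pole (z : R) : Prop := exists m : nat, z = - INR m.

(* 1 / Gamma z, with Gamma infinite at its poles. *)
Definition inv_Gamma (z : R) : R :=
  if excluded_middle_informative (Gamma_pole z) then 0 else / Gamma z.

(* L is the quotient Gamma (alpha + 1) / Gamma (alpha - s + 1), read as a limit.
   [is_lim] uses a punctured neighbourhood of alpha, on a small enough one of
   which neither argument of Gamma is a pole. *)
Definition is_Gamma_quotient (s : Q) (alpha L : R) : Prop :=
  is_lim (fun z => Gamma (z + 1) / Gamma (z - Q2R s + 1)) alpha L.

(* The term of index k = - (j + 1) of the complementary sum over k <= -1. *)
Definition complementary_term (s : Q) (c : Z -> R) (x : R) (j : nat) : R :=
  let k := (- Z.of_nat (S j))%Z in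
  c k * (Rpower x (IZR k - Q2R s) * inv_Gamma (IZR k - Q2R s + 1)).

(* g is, on x > 0, a derivative of order s of a x ^ alpha.  Only the values
   c k with k <= -1 matter. *)
Definition is_power_derivative (s : Q) (a alpha : R) (g : R -> R) : Prop :=
  ~ ((s == -1)%Q /\ alpha = -1) /\
  exists (L : R) (c : Z -> R),
    is_Gamma_quotient s alpha L /\
    forall x : R, 0 < x ->
      ex_series (complementary_term s c x) /\
      g x = a * L * Rpower x (alpha - Q2R s) + Series (complementary_term s c x).

(* Main.v *)
Require Import Defs.
From Stdlib Require Import Lra Lia ClassicalEpsilon.

(** At order n the arbitrary part of a fractional derivative disappears and the
    rest is the power rule.

    Every index k <= -1 gives a non-positive integer k - n + 1, a pole of the
    gamma function; so the complementary sum vanishes identically, whatever the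
    constants are ([complementary_term_of_nat]).

    The functional equation [Gamma (z + 1) = z * Gamma z] ([Gamma_succ]),
    iterated n times, shows that off the poles
    [Gamma (z + 1) / Gamma (z - n + 1)] is the polynomial
    z (z - 1) ... (z - n + 1).  Poles are isolated, so the limit at alpha exists
    and is the value of this polynomial there, even when alpha is an integer
    ([is_Gamma_quotient_of_nat]).  The same product is the coefficient of
    x ^ (alpha - n) in the n-th derivative of x ^ alpha ([is_derive_n_power]);
    it is written throughout as a rising product starting at z - n + 1.

    The analytic content is that Euler's integral converges, satisfies the
    recurrence ([is_Gamma_integral]) and does not vanish
    ([Gamma_integral_pos]), so that the gamma function can be cancelled in the
    quotient.  Convergence is needed directly only for arguments above 1, by
    comparison with a multiple of exp (- t / 2); integration by parts then
    gives it for arguments in (0, 1], together with the recurrence. *)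

(** * Powers, exponentials and neighbourhoods of the ends of the half-line *)

Lemma Rpower_pos (t w : R) : 0 < Rpower t w.
Proof. apply exp_pos. Qed.

Lemma is_derive_Rpower (p x : R) :
  0 < x -> is_derive (fun t => Rpower t p) x (p * Rpower x (p - 1)).
Proof.
  intros Hx. apply is_derive_Reals, derivable_pt_lim_power, Hx.
Qed.

Lemma continuous_Rpower (p x : R) : 0 < x -> continuous (fun t => Rpower t p) x.
Proof.
  intros Hx. apply (ex_derive_continuous (K := R_AbsRing) (V := R_NormedModule)).
  eexists. now apply is_derive_Rpower.
Qed.

Lemma continuous_exp_opp (c x : R) : continuous (fun t => exp (- (c * t))) x.
Proof.
  apply (ex_derive_continuous (K := R_AbsRing) (V := R_NormedModule)). auto_derive. exact I.
Qed.

Lemma at_right_0_pos : at_right 0 (fun a => 0 < a).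
Proof. now exists (mkposreal 1 Rlt_0_1). Qed.

Lemma p_infty_gt (M : R) : Rbar_locally p_infty (fun b => M < b).
Proof. now exists M. Qed.

(** * Improper integrals over the positive half-line *)

Lemma positive_integration_range (P : R -> Prop) :
  (forall x, 0 < x -> P x) ->
  filter_prod (at_right 0) (Rbar_locally p_infty)
    (fun ab => forall x, Rmin (fst ab) (snd ab) <= x <= Rmax (fst ab) (snd ab) -> P x).
Proof.
  intros HP. exists (fun a => 0 < a) (fun b => 0 < b).
  - apply at_right_0_pos.
  - apply p_infty_gt.
  - simpl. intros a b Ha Hb x [Hx _]. apply HP.
    apply Rlt_le_trans with (2 := Hx). now apply Rmin_glb_lt.
Qed.

Lemma ex_RInt_positive (f : R -> R) (a b : R) :
  (forall x, 0 < x -> continuous f x) -> 0 < a -> 0 < b -> ex_RInt f a b.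
Proof.
  intros Hf Ha Hb. apply (ex_RInt_continuous (V := R_CompleteNormedModule)).
  intros z [Hz _]. apply Hf.
  apply Rlt_le_trans with (2 := Hz). now apply Rmin_glb_lt.
Qed.

Lemma RInt_positive_Chasles (f : R -> R) (a b c : R) :
  (forall x, 0 < x -> continuous f x) -> 0 < a -> 0 < b -> 0 < c ->
  RInt f a b + RInt f b c = RInt f a c.
Proof.
  intros Hf Ha Hb Hc. apply (RInt_Chasles (V := R_CompleteNormedModule));
  now apply ex_RInt_positive.
Qed.

(** The absolute value on the right makes the bound insensitive to the order of
    the endpoints, which is unknown when two truncations of an improper
    integral are compared. *)
Lemma abs_RInt_le_abs_RInt (f g : R -> R) (a b : R) :
  (forall x, 0 < x -> continuous f x) ->
  (forall x, 0 < x -> continuous g x) ->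
  (forall x, 0 < x -> Rabs (f x) <= g x) ->
  0 < a -> 0 < b -> Rabs (RInt f a b) <= Rabs (RInt g a b).
Proof.
  intros Hf Hg Hfg.
  assert (W : forall a b, 0 < a -> a <= b -> Rabs (RInt f a b) <= Rabs (RInt g a b)).
  { intros u v Hu Huv.
    apply Rle_trans with (2 := Rle_abs _).
    apply (norm_RInt_le (V := R_NormedModule) f g u v); try assumption.
    - intros x Hx. apply Hfg; lra.
    - apply (RInt_correct (V := R_CompleteNormedModule)), ex_RInt_positive; auto; lra.
    - apply (RInt_correct (V := R_CompleteNormedModule)), ex_RInt_positive; auto; lra. }
  intros Ha Hb. destruct (Rle_dec a b) as [H|H]; [now apply W|].
  assert (S : forall h, (forall x, 0 < x -> continuous h x) ->
    Rabs (RInt h a b) = Rabs (RInt h b a)).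
  { intros h Hh. rewrite <- (opp_RInt_swap (V := R_CompleteNormedModule) h b a).
    - apply Rabs_Ropp.
    - now apply ex_RInt_positive. }
  rewrite (S f Hf), (S g Hg). apply W; lra.
Qed.

(** Turns the relational limit that defines an improper integral into the
    limit of a function, the form to which the Cauchy criterion and the
    comparison of limits apply. *)
Lemma is_RInt_gen_filterlim (f : R -> R) (l : R) :
  (forall x, 0 < x -> continuous f x) ->
  is_RInt_gen f (at_right 0) (Rbar_locally p_infty) l <->
  filterlim (fun ab => RInt f (fst ab) (snd ab))
    (filter_prod (at_right 0) (Rbar_locally p_infty)) (locally l).
Proof.
  intros Hf.
  assert (E : filter_prod (at_right 0) (Rbar_locally p_infty)
                (fun ab => 0 < fst ab /\ 0 < snd ab)).
  { exists (fun a => 0 < a) (fun b => 0 < b); auto using at_right_0_pos, p_infty_gt. }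
  split; intros H P HP; specialize (H P HP); unfold filtermap, filtermapi in *;
    generalize (filter_and _ _ E H); apply filter_imp; intros [a b]; simpl.
  - intros [[Ha Hb] [y [Hy Py]]]. now rewrite (is_RInt_unique _ _ _ _ Hy).
  - intros [[Ha Hb] Py]. exists (RInt f a b). split; [|exact Py].
    apply (RInt_correct (V := R_CompleteNormedModule)). now apply ex_RInt_positive.
Qed.

(** By the Cauchy criterion: moving the endpoints from (a, b) to (a', b')
    changes the integral of f by the integrals over [a, a'] and [b, b'], each
    bounded by the corresponding integral of g.  Moving a single endpoint at a
    time shows that both of these are small. *)
Lemma ex_RInt_gen_dominated (f g : R -> R) :
  (forall x, 0 < x -> continuous f x) ->
  (forall x, 0 < x -> continuous g x) ->
  (forall x, 0 < x -> Rabs (f x) <= g x) ->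
  ex_RInt_gen g (at_right 0) (Rbar_locally p_infty) ->
  ex_RInt_gen f (at_right 0) (Rbar_locally p_infty).
Proof.
  intros Hf Hg Hfg [lg Hlg].
  apply is_RInt_gen_filterlim in Hlg; [|assumption].
  enough (H : exists l : R_CompleteSpace, filterlim (fun ab => RInt f (fst ab) (snd ab))
    (filter_prod (at_right 0) (Rbar_locally p_infty)) (locally l)).
  { destruct H as [l Hl]. exists l. now apply is_RInt_gen_filterlim. }
  apply filterlim_locally_cauchy. intros eps.
  destruct (proj2 (filterlim_locally_cauchy (U := R_CompleteSpace)
     (fun ab => RInt g (fst ab) (snd ab))) (ex_intro _ lg Hlg) (pos_div_2 eps))
    as [P [[A B HA HB HAB] HP]].
  exists (fun ab => (A (fst ab) /\ 0 < fst ab) /\ (B (snd ab) /\ 0 < snd ab)). split.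
  { exists (fun a => A a /\ 0 < a) (fun b => B b /\ 0 < b); auto.
    - apply filter_and; [exact HA|apply at_right_0_pos].
    - apply filter_and; [exact HB|apply p_infty_gt]. }
  intros [a b] [a' b']; simpl. intros [[Aa Ha] [Bb Hb]] [[Aa' Ha'] [Bb' Hb']].
  generalize (HP (a, b) (a', b) (HAB _ _ Aa Bb) (HAB _ _ Aa' Bb)).
  generalize (HP (a, b) (a, b') (HAB _ _ Aa Bb) (HAB _ _ Aa Bb')).
  unfold ball; simpl; unfold AbsRing_ball, abs, minus, plus, opp; simpl.
  generalize (RInt_positive_Chasles g a a' b Hg Ha Ha' Hb)
    (RInt_positive_Chasles g a b b' Hg Ha Hb Hb')
    (RInt_positive_Chasles f a a' b' Hf Ha Ha' Hb')
    (RInt_positive_Chasles f a b b' Hf Ha Hb Hb')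
    (abs_RInt_le_abs_RInt f g a a' Hf Hg Hfg Ha Ha')
    (abs_RInt_le_abs_RInt f g b b' Hf Hg Hfg Hb Hb').
  intros G1 G2 F1 F2 M1 M2 E1 E2.
  replace (RInt g a b' + - RInt g a b) with (RInt g b b') in E1 by lra.
  replace (RInt g a' b + - RInt g a b) with (- RInt g a a') in E2 by lra.
  rewrite Rabs_Ropp in E2.
  replace (RInt f a' b' + - RInt f a b) with (RInt f b b' + - RInt f a a') by lra.
  apply Rle_lt_trans with (1 := Rabs_triang _ _). rewrite Rabs_Ropp. lra.
Qed.

(** * Exponential bounds *)

(** The constant comes from [ln u <= u] at u = t / (2 w): multiplying by w
    and exponentiating gives (t / (2 w)) ^ w <= exp (t / 2). *)
Lemma Rpower_le_exp_half (w t : R) :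
  0 < w -> 0 < t -> Rpower t w <= Rpower (2 * w) w * exp (t / 2).
Proof.
  intros Hw Ht.
  replace t with (2 * w * (t / (2 * w))) at 1 by (field; lra).
  assert (Hq : 0 < t / (2 * w)) by (apply Rdiv_lt_0_compat; lra).
  rewrite <- Rpower_mult_distr by lra.
  apply Rmult_le_compat_l; [left; apply Rpower_pos|].
  replace (t / 2) with (w * (t / (2 * w))) by (field; lra).
  unfold Rpower.
  assert (L : ln (t / (2 * w)) <= t / (2 * w)).
  { rewrite <- (ln_exp (t / (2 * w))) at 2. apply ln_le; [exact Hq|].
    generalize (exp_ineq1_le (t / (2 * w))). lra. }
  destruct (Rmult_le_compat_l w _ _ (Rlt_le _ _ Hw) L) as [H|H].
  - left. now apply exp_increasing.
  - right. now rewrite H.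
Qed.

Lemma Rpower_exp_opp_le (w t : R) :
  0 < w -> 0 < t -> Rpower t w * exp (- t) <= Rpower (2 * w) w * exp (- (/ 2 * t)).
Proof.
  intros Hw Ht.
  replace (exp (- (/ 2 * t))) with (exp (t / 2) * exp (- t)).
  - rewrite <- Rmult_assoc. apply Rmult_le_compat_r; [left; apply exp_pos|].
    now apply Rpower_le_exp_half.
  - rewrite <- exp_plus. f_equal. field.
Qed.

Lemma filterlim_exp_opp_half_p_infty :
  filterlim (fun t => exp (- (/ 2 * t))) (Rbar_locally p_infty) (locally 0).
Proof.
  change (is_lim (fun t => exp (- (/ 2 * t))) p_infty 0).
  apply (is_lim_comp exp _ p_infty 0 m_infty).
  - apply is_lim_exp_m.
  - evar_last; [apply is_lim_opp, (is_lim_scal_l (fun t => t) (/ 2) p_infty p_infty), is_lim_id|].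
    simpl. destruct (Rle_dec 0 (/ 2)) as [H|H]; [|lra].
    destruct (Rle_lt_or_eq_dec 0 (/ 2) H); [reflexivity|lra].
  - exists 0. discriminate.
Qed.

Lemma ex_RInt_gen_exp_opp_half :
  ex_RInt_gen (fun t => exp (- (/ 2 * t))) (at_right 0) (Rbar_locally p_infty).
Proof.
  assert (D : forall x, is_derive (fun t => -2 * exp (- (/ 2 * t))) x (exp (- (/ 2 * x)))).
  { intros x. auto_derive; [exact I|]. field. }
  exists (-2 * 0 - -2 * exp (- (/ 2 * 0))).
  apply is_RInt_gen_ext with (f := Derive (fun t => -2 * exp (- (/ 2 * t)))).
  { apply filter_forall. intros ab x _. now apply is_derive_unique. }
  apply is_RInt_gen_Derive.
  - apply filter_forall. intros ab x _. eexists; apply D.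
  - apply filter_forall. intros ab x _.
    apply continuous_ext with (fun t => exp (- (/ 2 * t))).
    + intros t. symmetry. now apply is_derive_unique.
    + apply continuous_exp_opp.
  - apply (filterlim_filter_le_1 (F := locally 0) (G := at_right 0)
      (fun t => -2 * exp (- (/ 2 * t)))); [apply filter_le_within|].
    apply (ex_derive_continuous (K := R_AbsRing) (V := R_NormedModule)
      (fun t => -2 * exp (- (/ 2 * t))) 0).
    eexists; apply D.
  - apply (filterlim_comp _ _ _ (fun t => exp (- (/2 * t))) (fun y => -2 * y) _ (locally 0)).
    + apply filterlim_exp_opp_half_p_infty.
    + apply (continuous_scal_r (K := R_AbsRing) (V := R_NormedModule) (-2) (fun y => y)), continuous_id.
Qed.

(** * Euler's integral *)

Lemma continuous_Gamma_integrand (z x : R) :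
  0 < x -> continuous (fun t => Rpower t (z - 1) * exp (- t)) x.
Proof.
  intros Hx. apply (continuous_mult (K := R_AbsRing)).
  - now apply continuous_Rpower.
  - apply continuous_ext with (fun t => exp (- (1 * t))).
    + intros t. now rewrite Rmult_1_l.
    + apply continuous_exp_opp.
Qed.

(** For an argument exceeding 1 the integrand stays bounded near 0, so a single
    exponential dominates it on the whole half-line.  Arguments in (0, 1] are
    reached from here by [is_Gamma_integral]. *)
Lemma ex_Gamma_integral_succ (w : R) :
  0 < w ->
  ex_RInt_gen (fun t => Rpower t (w + 1 - 1) * exp (- t))
    (at_right 0) (Rbar_locally p_infty).
Proof.
  intros Hw.
  apply ex_RInt_gen_dominated with (fun t => Rpower (2 * w) w * exp (- (/ 2 * t))).
  - apply continuous_Gamma_integrand.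
  - intros x _. apply (continuous_scal_r (K := R_AbsRing) (V := R_NormedModule)), continuous_exp_opp.
  - intros x Hx. replace (w + 1 - 1) with w by ring.
    rewrite Rabs_pos_eq by (left; apply Rmult_lt_0_compat; apply exp_pos).
    now apply Rpower_exp_opp_le.
  - destruct ex_RInt_gen_exp_opp_half as [l Hl]. exists (Rpower (2 * w) w * l).
    exact (is_RInt_gen_scal _ (Rpower (2 * w) w) l Hl).
Qed.

Lemma filterlim_Rpower_at_right_0 (w : R) :
  0 < w -> filterlim (fun t => Rpower t w) (at_right 0) (locally 0).
Proof.
  intros Hw. apply filterlim_locally. intros eps.
  (* The radius solves y ^ w = eps. *)
  exists (mkposreal _ (Rpower_pos eps (/ w))). intros y Hy Hy0.
  unfold ball in *; simpl in *; unfold AbsRing_ball, abs, minus, plus, opp in *; simpl in *.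
  rewrite Ropp_0, Rplus_0_r in *.
  rewrite Rabs_pos_eq in * by (left; (assumption || apply exp_pos)).
  replace (pos eps) with (Rpower (Rpower eps (/ w)) w).
  - now apply Rlt_Rpower_l.
  - rewrite Rpower_mult, Rinv_l, Rpower_1; [reflexivity|apply cond_pos|lra].
Qed.

Lemma filterlim_Rpower_exp_opp_at_right_0 (w : R) :
  0 < w -> filterlim (fun t => Rpower t w * exp (- t)) (at_right 0) (locally 0).
Proof.
  intros Hw.
  apply (filterlim_le_le (F := at_right 0) (fun _ => 0) _ (fun t => Rpower t w) (Finite 0)).
  - generalize at_right_0_pos. apply filter_imp. intros t Ht. split.
    + left. apply Rmult_lt_0_compat; apply exp_pos.
    + rewrite <- (Rmult_1_r (Rpower t w)) at 2.
      apply Rmult_le_compat_l; [left; apply Rpower_pos|].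
      rewrite <- exp_0. left. apply exp_increasing. lra.
  - apply filterlim_const.
  - now apply filterlim_Rpower_at_right_0.
Qed.

Lemma filterlim_Rpower_exp_opp_p_infty (w : R) :
  0 < w ->
  filterlim (fun t => Rpower t w * exp (- t)) (Rbar_locally p_infty) (locally 0).
Proof.
  intros Hw.
  apply (filterlim_le_le (F := Rbar_locally p_infty) (fun _ => 0) _
    (fun t => Rpower (2 * w) w * exp (- (/ 2 * t))) (Finite 0)).
  - generalize (p_infty_gt 0). apply filter_imp. intros t Ht. split.
    + left. apply Rmult_lt_0_compat; apply exp_pos.
    + now apply Rpower_exp_opp_le.
  - apply filterlim_const.
  - simpl. rewrite <- (Rmult_0_r (Rpower (2 * w) w)).
    apply (filterlim_comp _ _ _ (fun t => exp (- (/2 * t)))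
      (fun y => Rpower (2 * w) w * y) _ (locally 0)).
    + apply filterlim_exp_opp_half_p_infty.
    + apply (continuous_scal_r (K := R_AbsRing) (V := R_NormedModule)
        (Rpower (2 * w) w) (fun y => y)), continuous_id.
Qed.

(** Integration by parts, read backwards: the derivative of t ^ w exp (- t) is
    w t ^ (w - 1) exp (- t) - t ^ w exp (- t), and its integral is 0 because
    t ^ w exp (- t) vanishes at both ends.  So the convergence of the integral
    at w + 1 yields both the convergence at w and the recurrence. *)
Lemma is_Gamma_integral (w : R) :
  0 < w ->
  is_RInt_gen (fun t => Rpower t (w - 1) * exp (- t))
    (at_right 0) (Rbar_locally p_infty) (Gamma_integral (w + 1) / w).
Proof.
  intros Hw.
  set (f := fun t => Rpower t w * exp (- t)).
  assert (D : forall x, 0 < x -> is_derive f x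
    (w * (Rpower x (w - 1) * exp (- x)) - Rpower x (w + 1 - 1) * exp (- x))).
  { intros x Hx. unfold f. evar_last.
    - apply (is_derive_mult (K := R_AbsRing) (fun t => Rpower t w) (fun t => exp (- t))).
      + now apply is_derive_Rpower.
      + auto_derive; [exact I|reflexivity].
      + intros; apply Rmult_comm.
    - unfold plus, mult; simpl. replace (w + 1 - 1) with w by ring. ring. }
  assert (B : is_RInt_gen (Derive f) (at_right 0) (Rbar_locally p_infty) (0 - 0)).
  { apply is_RInt_gen_Derive.
    - apply positive_integration_range. intros x Hx. eexists; now apply D.
    - apply positive_integration_range. intros x Hx.
      apply continuous_ext_loc with
        (fun x => w * (Rpower x (w - 1) * exp (- x)) - Rpower x (w + 1 - 1) * exp (- x)).
      + generalize (open_gt 0 x Hx). apply filter_imp.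
        intros y Hy. symmetry. now apply is_derive_unique, D.
      + apply (continuous_minus (V := R_NormedModule)).
        * apply (continuous_scal_r (K := R_AbsRing) (V := R_NormedModule)).
          now apply continuous_Gamma_integrand.
        * now apply continuous_Gamma_integrand.
    - now apply filterlim_Rpower_exp_opp_at_right_0.
    - now apply filterlim_Rpower_exp_opp_p_infty. }
  assert (G : is_RInt_gen (fun t => Rpower t (w + 1 - 1) * exp (- t))
    (at_right 0) (Rbar_locally p_infty) (Gamma_integral (w + 1))).
  { apply (RInt_gen_correct (V := R_CompleteNormedModule)).
    now apply ex_Gamma_integral_succ. }
  replace (Gamma_integral (w + 1) / w) with (/ w * ((0 - 0) + Gamma_integral (w + 1)))
    by (field; lra).
  generalize (is_RInt_gen_scal _ (/ w) _ (is_RInt_gen_plus _ _ _ _ B G)).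
  apply is_RInt_gen_ext.
  eapply filter_imp; [|apply (positive_integration_range (fun x => 0 < x)); auto].
  intros ab H x Hx. assert (Hx0 : 0 < x) by (apply H; lra).
  rewrite (is_derive_unique _ _ _ (D x Hx0)).
  unfold scal, plus, mult; simpl; unfold mult; simpl. field. lra.
Qed.

Lemma Gamma_integral_succ (w : R) :
  0 < w -> Gamma_integral (w + 1) = w * Gamma_integral w.
Proof.
  intros Hw. unfold Gamma_integral at 2.
  rewrite (is_RInt_gen_unique _ _ (is_Gamma_integral w Hw)). field. lra.
Qed.

(** The integrand is positive, so the truncated integrals eventually exceed
    the one over [1, 2]. *)
Lemma Gamma_integral_pos (w : R) : 0 < w -> 0 < Gamma_integral w.
Proof.
  intros Hw.
  assert (H : is_RInt_gen (fun t => Rpower t (w - 1) * exp (- t))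
     (at_right 0) (Rbar_locally p_infty) (Gamma_integral w)).
  { unfold Gamma_integral. rewrite (is_RInt_gen_unique _ _ (is_Gamma_integral w Hw)).
    now apply is_Gamma_integral. }
  apply is_RInt_gen_filterlim in H; [|apply continuous_Gamma_integrand].
  set (f := fun t => Rpower t (w - 1) * exp (- t)) in *.
  assert (Cf : forall x, 0 < x -> continuous f x) by apply continuous_Gamma_integrand.
  assert (Pf : forall x, 0 < f x) by (intros; apply Rmult_lt_0_compat; apply exp_pos).
  assert (P : forall a b, 0 < a -> a < b -> 0 < RInt f a b).
  { intros a b Ha Hab. apply RInt_gt_0; auto. intros x Hx. apply Cf. lra. }
  apply Rlt_le_trans with (RInt f 1 2); [apply P; lra|].
  apply (filterlim_le (F := filter_prod (at_right 0) (Rbar_locally p_infty))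
    (fun _ => RInt f 1 2) (fun ab => RInt f (fst ab) (snd ab))
    (Finite (RInt f 1 2)) (Finite (Gamma_integral w))).
  - exists (fun a => 0 < a < 1) (fun b => 2 < b).
    + exists (mkposreal 1 Rlt_0_1). intros y Hy Hy0. split; [exact Hy0|].
      apply Rabs_lt_between in Hy. unfold minus, plus, opp in Hy; simpl in Hy. lra.
    + apply p_infty_gt.
    + simpl. intros a b Ha Hb.
      rewrite <- (RInt_positive_Chasles f a 1 b), <- (RInt_positive_Chasles f 1 2 b) by (auto; lra).
      generalize (P a 1) (P 2 b). lra.
  - apply filterlim_const.
  - exact H.
Qed.

(** * The functional equation of the gamma function *)

(** [rising] grows by its last factor; the recurrence of [Gamma] and the
    repeated derivatives both bring out a new first factor. *)
Lemma rising_S_l (z : R) (m : nat) : rising z (S m) = z * rising (z + 1) m.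
Proof.
  induction m as [|m IH]; [simpl; ring|].
  change (rising z (S (S m))) with (rising z (S m) * (z + INR (S m))).
  rewrite IH, S_INR. simpl. ring.
Qed.

Lemma rising_neq_0 (z : R) (m : nat) : ~ Gamma_pole z -> rising z m <> 0.
Proof.
  intros Hz. induction m as [|m IH]; simpl; [lra|].
  apply Rmult_integral_contrapositive. split; [exact IH|].
  intros E. apply Hz. exists m. lra.
Qed.

Lemma Gamma_pole_pred (z : R) : Gamma_pole (z + 1) -> Gamma_pole z.
Proof. intros [m Hm]. exists (S m). rewrite S_INR. lra. Qed.

Lemma Gamma_shift_pos (z : R) : 0 < z -> Gamma_shift z = 0%nat.
Proof.
  intros Hz. unfold Gamma_shift. destruct (archimed (- z)) as [_ H].
  assert (up (- z) < 1)%Z by (apply lt_IZR; lra). lia.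
Qed.

Lemma Gamma_shift_neg (z : R) : z < 0 -> Gamma_shift z = S (Gamma_shift (z + 1)).
Proof.
  intros Hz. unfold Gamma_shift. destruct (archimed (- z)) as [H1 H2].
  assert (0 < up (- z))%Z by (apply lt_IZR; lra).
  rewrite <- (tech_up (- (z + 1)) (up (- z) - 1)) by (rewrite minus_IZR; lra).
  lia.
Qed.

Lemma Gamma_shift_spec (z : R) : 0 < z + INR (Gamma_shift z).
Proof.
  unfold Gamma_shift. destruct (archimed (- z)) as [H _].
  rewrite INR_IZR_INZ.
  assert (up (- z) <= Z.of_nat (Z.to_nat (up (- z))))%Z as L by lia.
  apply IZR_le in L. lra.
Qed.

Lemma Gamma_neq_0 (z : R) : ~ Gamma_pole z -> Gamma z <> 0.
Proof.
  intros Hz. unfold Gamma, Rdiv. apply Rmult_integral_contrapositive. split.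
  - apply Rgt_not_eq, Gamma_integral_pos, Gamma_shift_spec.
  - now apply Rinv_neq_0_compat, rising_neq_0.
Qed.

(** For z > 0 neither side is shifted and this is integration by parts.  For
    z < 0 both sides involve Euler's integral at the same point, and the
    factor z is the first one of the rising product. *)
Lemma Gamma_succ (z : R) : ~ Gamma_pole z -> Gamma (z + 1) = z * Gamma z.
Proof.
  intros Hz. unfold Gamma. destruct (Rtotal_order z 0) as [H|[H|H]].
  - rewrite (Gamma_shift_neg z H), rising_S_l, S_INR.
    replace (z + (INR (Gamma_shift (z + 1)) + 1)) with (z + 1 + INR (Gamma_shift (z + 1)))
      by ring.
    field. split; [|lra]. apply rising_neq_0. contradict Hz. now apply Gamma_pole_pred.
  - exfalso. apply Hz. exists 0%nat. simpl. lra.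
  - rewrite !Gamma_shift_pos by lra. simpl. rewrite !Rplus_0_r, Gamma_integral_succ by exact H.
    field.
Qed.

Lemma Gamma_plus_nat (w : R) (n : nat) :
  ~ Gamma_pole w -> Gamma (w + INR n) = rising w n * Gamma w.
Proof.
  intros Hw. induction n as [|n IH].
  - simpl. rewrite Rplus_0_r. ring.
  - rewrite S_INR, <- Rplus_assoc, Gamma_succ, IH; [simpl; ring|].
    intros [m Hm]. apply Hw. exists (n + m)%nat. rewrite plus_INR. lra.
Qed.

(** * The gamma quotient and the complementary sum at integer order *)

(** The poles are integers, so it is enough to stay within the open unit
    interval that contains alpha + c or, when alpha + c is an integer, within
    distance 1 of it. *)
Lemma locally_punctured_not_pole (c alpha : R) :
  Rbar_locally' alpha (fun z => ~ Gamma_pole (z + c)).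
Proof.
  (* p is the integer with p - 1 <= alpha + c < p. *)
  destruct (archimed (alpha + c)) as [H1 H2].
  set (p := up (alpha + c)) in *.
  assert (I : forall z, Gamma_pole (z + c) -> exists k : Z, z + c = IZR k).
  { intros z [m Hm]. exists (- Z.of_nat m)%Z. now rewrite opp_IZR, <- INR_IZR_INZ. }
  assert (D : exists d : posreal, alpha + c + d <= IZR p /\
     (alpha + c = IZR p - 1 /\ pos d = 1 \/ IZR p - 1 <= alpha + c - d)).
  { destruct (Req_dec (alpha + c) (IZR p - 1)) as [E|E].
    - exists (mkposreal 1 Rlt_0_1). simpl. lra.
    - assert (Hd : 0 < Rmin (alpha + c - (IZR p - 1)) (IZR p - (alpha + c)))
        by (apply Rmin_glb_lt; lra).
      exists (mkposreal _ Hd). simpl.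
      generalize (Rmin_l (alpha + c - (IZR p - 1)) (IZR p - (alpha + c)))
        (Rmin_r (alpha + c - (IZR p - 1)) (IZR p - (alpha + c))). lra. }
  destruct D as [d [D1 D2]].
  exists d. intros z Hz Hne P. destruct (I z P) as [k Hk].
  apply Rabs_lt_between in Hz. unfold minus, plus, opp in Hz; simpl in Hz.
  assert (K1 : (k < p)%Z) by (apply lt_IZR; lra).
  destruct D2 as [[E1 E2]|D2].
  - assert (K2 : (p - 2 < k)%Z) by (apply lt_IZR; rewrite minus_IZR; lra).
    assert (K : k = (p - 1)%Z) by lia. rewrite K, minus_IZR in Hk. lra.
  - assert (K2 : (p - 1 < k)%Z) by (apply lt_IZR; rewrite minus_IZR; lra). lia.
Qed.

Lemma continuous_rising (c : R) (n : nat) (x : R) :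
  continuous (fun z => rising (z + c) n) x.
Proof.
  induction n as [|n IH]; simpl; [apply continuous_const|].
  apply (continuous_mult (K := R_AbsRing)); [exact IH|].
  apply (continuous_plus (V := R_NormedModule)); [|apply continuous_const].
  apply (continuous_plus (V := R_NormedModule)); [apply continuous_id|apply continuous_const].
Qed.

Lemma Q2R_of_nat (n : nat) : Q2R (inject_Z (Z.of_nat n)) = INR n.
Proof. unfold Q2R, inject_Z; simpl. rewrite INR_IZR_INZ. field. Qed.

(** With w = z - n + 1, the quotient is [Gamma (w + n) / Gamma w], which off the
    poles is the polynomial z (z - 1) ... (z - n + 1), continuous at alpha even
    when w is a pole there. *)
Lemma is_Gamma_quotient_of_nat (n : nat) (alpha : R) :
  is_Gamma_quotient (inject_Z (Z.of_nat n)) alpha (rising (alpha + (1 - INR n)) n).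
Proof.
  unfold is_Gamma_quotient. rewrite Q2R_of_nat.
  apply is_lim_ext_loc with (fun z => rising (z + (1 - INR n)) n).
  - generalize (locally_punctured_not_pole (1 - INR n) alpha).
    apply filter_imp. intros z Hz.
    replace (z - INR n + 1) with (z + (1 - INR n)) by ring.
    replace (z + 1) with (z + (1 - INR n) + INR n) by ring.
    rewrite (Gamma_plus_nat _ n Hz). field. now apply Gamma_neq_0.
  - apply (is_lim_continuity (fun z => rising (z + (1 - INR n)) n) alpha).
    apply continuity_pt_filterlim, continuous_rising.
Qed.

(** For k = - (j + 1) the argument k - n + 1 = - (j + n) of [inv_Gamma] is a
    pole. *)
Lemma complementary_term_of_nat (n : nat) (c : Z -> R) (x : R) (j : nat) :
  complementary_term (inject_Z (Z.of_nat n)) c x j = 0.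
Proof.
  unfold complementary_term, inv_Gamma.
  destruct excluded_middle_informative as [_|N]; [ring|].
  exfalso. apply N. exists (j + n)%nat.
  rewrite Q2R_of_nat, opp_IZR, <- INR_IZR_INZ, S_INR, plus_INR. ring.
Qed.

Lemma is_series_complementary_of_nat (n : nat) (c : Z -> R) (x : R) :
  is_series (complementary_term (inject_Z (Z.of_nat n)) c x) 0.
Proof.
  apply is_series_ext with (fun _ => 0).
  - intros j. symmetry. apply complementary_term_of_nat.
  - apply (is_lim_seq_ext (fun _ => 0) _ (Finite 0)); [|apply is_lim_seq_const].
    intros m. rewrite sum_n_const. ring.
Qed.

(** * Ordinary derivatives of powers *)

Lemma is_derive_n_power (n : nat) (a alpha x : R) :
  0 < x ->
  is_derive_n (fun y => a * Rpower y alpha) n x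
    (a * rising (alpha + (1 - INR n)) n * Rpower x (alpha - INR n)).
Proof.
  revert x. induction n as [|n IH]; intros x Hx.
  - simpl. rewrite Rminus_0_r. ring.
  - unfold is_derive_n.
    apply is_derive_ext_loc with
      (fun y => a * rising (alpha + (1 - INR n)) n * Rpower y (alpha - INR n)).
    + generalize (open_gt 0 x Hx). apply filter_imp.
      intros y Hy. symmetry. now apply is_derive_n_unique, IH.
    + evar_last; [apply is_derive_scal, is_derive_Rpower, Hx|].
      rewrite rising_S_l, S_INR.
      replace (alpha + (1 - (INR n + 1)) + 1) with (alpha + (1 - INR n)) by ring.
      replace (alpha - (INR n + 1)) with (alpha - INR n - 1) by ring. ring.
Qed.

Theorem theorem3p1 (n : nat) (a alpha : R) :
  (exists g : R -> R, is_power_derivative (inject_Z (Z.of_nat n)) a alpha g) /\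
  (forall g : R -> R,
     is_power_derivative (inject_Z (Z.of_nat n)) a alpha g ->
     forall x : R, 0 < x ->
       is_derive_n (fun y => a * Rpower y alpha) n x (g x)).
Proof.
  set (s := inject_Z (Z.of_nat n)).
  assert (Z0 : forall c x, is_series (complementary_term s c x) 0)
    by apply is_series_complementary_of_nat.
  split.
  - exists (fun x => a * rising (alpha + (1 - INR n)) n * Rpower x (alpha - Q2R s)
        + Series (complementary_term s (fun _ => 0) x)).
    split.
    + intros [H _]. unfold s, Qeq in H; simpl in H. lia.
    + exists (rising (alpha + (1 - INR n)) n), (fun _ => 0). split.
      * apply is_Gamma_quotient_of_nat.
      * intros x _. split; [eexists; apply Z0|reflexivity].
  - intros g [_ [L [c [HL Hg]]]] x Hx. destruct (Hg x Hx) as [_ ->].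
    rewrite (is_series_unique _ _ (Z0 c x)), Rplus_0_r.
    assert (E : Finite L = Finite (rising (alpha + (1 - INR n)) n)).
    { rewrite <- (is_lim_unique _ _ _ HL). apply is_lim_unique, is_Gamma_quotient_of_nat. }
    injection E as ->. unfold s. rewrite Q2R_of_nat. now apply is_derive_n_power.
Qed.
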